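(* Let $P_t:\Sigma\to\mathbf{R}^3_1$, $0\le t\le1$, be a nontrivial flex of a closed (compact, without boundary) orientable polyhedron in the Minkowski 3-space. Then the generalized volume $\mathrm{Vol}\,P_t$ is independent of $t$.
   Context: $\mathbf{R}^3_1$ is $\mathbf{R}^3$ with scalar product $(x,y)=x_1y_1+x_2y_2-x_3y_3$ and length $|x|=\sqrt{(x,x)}$. A polyhedron is a continuous map $P:\Sigma\to\mathbf{R}^3_1$, $\Sigma$ a connected 2-dimensional simplicial complex that is a manifold, affine and injective on each simplex. A nontrivial flex of $P$ is a family of polyhedra $P_t:\Sigma\to\mathbf{R}^3_1$, analytic in $t\in[0,1]$, with $P_0=P$, every edge length $|P_t(v)-P_t(w)|$ ($vw$ an edge of $\Sigma$) independent of $t$, and some pair of vertices whose Minkowski distance is nonconstant in $t$. The volume of a domain in $\mathbf{R}^3_1$ is its Euclidean volume as a subset of $\mathbf{R}^3$. For a closed oriented polyhedron $P$ and any point $p_*$, the generalized volume is $\mathrm{Vol}\,P=\sum_\Delta\varepsilon(p_*,\Delta)\,\mathrm{vol}[p_*,\Delta]$, the sum over all positively oriented 2-simplices $\Delta$ of $P$, where $[p_*,\Delta]$ is the tetrahedron spanned by $p_*$ and $P(\Delta)$ with orientation induced from $\Delta$, and $\varepsilon(p_*,\Delta)=+1$ or $-1$ according as this orientation agrees or disagrees with that of the space (equivalently, $\mathrm{Vol}\,P=\frac16\sum\det(P(a),P(b),P(c))$ over positively oriented triangles $(a,b,c)$; it is independent of $p_*$). *)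

(* Defs.v *)
From HB Require Import structures.
From mathcomp Require Import all_boot all_order all_algebra.
From mathcomp Require Import all_classical all_reals all_analysis.
Set Implicit Arguments. Unset Strict Implicit. Unset Printing Implicit Defensive.
Import Order.TTheory GRing.Theory Num.Theory.
Import numFieldNormedType.Exports.
Local Open Scope classical_set_scope.
Local Open Scope ring_scope.

(* Sigma is described by a finite vertex type V and the set F of its
   positively oriented 2-simplices (a,b,c) (one representative per triangle). *)

Section Surface.
Variable V : finType.
Implicit Type F : {set V * V * V}.

Definition tri_verts (t : V * V * V) : {set V} :=
  [set t.1.1; t.1.2; t.2].

Definition in_tri (t : V * V * V) (u w : V) : bool :=
  let: (a, b, c) := t in
  [|| (u == a) && (w == b), (u == b) && (w == c) | (u == c) && (w == a)].

Definition sedge F (u w : V) : bool := [exists t in F, in_tri t u w].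

Definition link_rel F (v : V) : rel V :=
  fun x y => [exists t in F, in_tri t v x && in_tri t x y].

Definition closed_oriented_surface F : Prop :=
      (forall t, t \in F -> #|tri_verts t| = 3) /\
      (forall t1 t2, t1 \in F -> t2 \in F -> tri_verts t1 = tri_verts t2 -> t1 = t2) /\
      (forall v : V, exists2 t, t \in F & v \in tri_verts t) /\
      (* coherent orientation: every directed edge is used by at most one
         triangle, and closedness: whenever (u,w) is used, so is (w,u);
         hence each edge lies in exactly two triangles with opposite
         induced orientations *)
      (forall t1 t2 u w, t1 \in F -> t2 \in F ->
          in_tri t1 u w -> in_tri t2 u w -> t1 = t2) /\
      (forall t u w, t \in F -> in_tri t u w -> sedge F w u) /\
      (* manifold at vertices: the link of every vertex is a single cycle *)
      (forall v u w, sedge F v u -> sedge F v w -> connect (link_rel F v) u w) /\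
      (forall u w : V, connect (sedge F) u w).
End Surface.

Section Minkowski.
Variable R : realType.

Definition ax0 : 'I_3 := @Ordinal 3 0 isT.
Definition ax1 : 'I_3 := @Ordinal 3 1 isT.
Definition ax2 : 'I_3 := @Ordinal 3 2 isT.

Definition mdot (x y : 'rV[R]_3) : R :=
  x 0 ax0 * y 0 ax0 + x 0 ax1 * y 0 ax1 - x 0 ax2 * y 0 ax2.

Definition mdist2 (x y : 'rV[R]_3) : R := mdot (x - y) (x - y).

Definition mx3 (p q r : 'rV[R]_3) : 'M[R]_3 :=
  \matrix_(i < 3, j < 3)
    (if val i == 0%N then p 0 j else if val i == 1%N then q 0 j else r 0 j).

(* P is a polyhedron: the affine extension of P on each triangle is injective *)
Definition polyhedron (V : finType) (F : {set V * V * V}) (P : V -> 'rV[R]_3) : Prop :=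
  forall a b c, (a, b, c) \in F ->
    forall la lb lc ma mb mc : R,
      0 <= la -> 0 <= lb -> 0 <= lc -> la + lb + lc = 1 ->
      0 <= ma -> 0 <= mb -> 0 <= mc -> ma + mb + mc = 1 ->
      la *: P a + lb *: P b + lc *: P c = ma *: P a + mb *: P b + mc *: P c ->
      [/\ la = ma, lb = mb & lc = mc].

Definition gvol (V : finType) (F : {set V * V * V}) (P : V -> 'rV[R]_3) : R :=
  6^-1 * \sum_(t in F) \det (mx3 (P t.1.1) (P t.1.2) (P t.2)).

Definition analytic01 (f : R -> R) : Prop :=
  forall t0 : R, 0 <= t0 <= 1 ->
    exists r : R, 0 < r /\
    exists a : nat -> R,
      forall t : R, 0 <= t <= 1 -> `|t - t0| < r ->
        (fun n : nat => \sum_(k < n) a k * (t - t0) ^+ k) @ \oo --> f t.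

Definition nontrivial_flex (V : finType) (F : {set V * V * V})
    (P : R -> V -> 'rV[R]_3) : Prop :=
  [/\ (forall t, 0 <= t <= 1 -> polyhedron F (P t)),
      (forall (v : V) (i : 'I_3), analytic01 (fun t => P t v 0 i)),
      (forall u w, sedge F u w -> forall t, 0 <= t <= 1 ->
          mdist2 (P t u) (P t w) = mdist2 (P 0 u) (P 0 w))
    & (exists u w : V, exists t1 t2 : R, 0 <= t1 <= 1 /\ 0 <= t2 <= 1 /\
          mdist2 (P t1 u) (P t1 w) <> mdist2 (P t2 u) (P t2 w))].
End Minkowski.

(* Main.v *)
(* Vol P_t depends continuously on t, so it suffices that it takes countably
   many values; we show (following Sabitov and Connelly-Sabitov-Walz) that
   x = 6 Vol P_t is integral over the countable ring generated by 1/2 and the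
   squared edge lengths.  Otherwise some valuation ring O of R contains that
   ring but not x.  Call a pair of vertices finite when its squared distance is
   in O; all edges of the surface are finite.
   In the link of a vertex q with respect to finite pairs, every closed walk of
   length at least 4 has a finite short chord: if all short chords had poles,
   the vanishing of the 4 x 4 Gram determinants in 3-space would make the poles
   of the products (v_0, v_k) grow with k, and the walk could not close.  Hence
   1-cocycles modulo O on the link are coboundaries.  Since a tetrahedron with
   finite edges has its volume in O, adding the vertices one at a time writes
   (a, b, c) |-> det (P a, P b, P c) as a coboundary modulo O on finite
   triangles, and its sum over a closed oriented surface is in O. *)
Require Import Defs.
From HB Require Import structures.
From mathcomp Require Import all_boot all_order all_algebra.
From mathcomp Require Import all_classical all_reals all_analysis.
From mathcomp Require Import ring lra zify.
Import Order.TTheory GRing.Theory Num.Theory.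
Import numFieldNormedType.Exports.
Local Open Scope ring_scope.
Set Implicit Arguments. Unset Strict Implicit. Unset Printing Implicit Defensive.

(** * Determinants and Gram identities in Minkowski 3-space *)

Lemma det_mx3 (R : realType) (p q r : 'rV[R]_3) :
  \det (mx3 p q r) =
    p 0 ax0 * (q 0 ax1 * r 0 ax2 - q 0 ax2 * r 0 ax1)
  - p 0 ax1 * (q 0 ax0 * r 0 ax2 - q 0 ax2 * r 0 ax0)
  + p 0 ax2 * (q 0 ax0 * r 0 ax1 - q 0 ax1 * r 0 ax0).
Proof.
rewrite (expand_det_row _ ax0) !big_ord_recl big_ord0 /cofactor.
rewrite !(expand_det_row _ ord0) !big_ord_recl !big_ord0 /cofactor !det_mx11.
rewrite !mxE /=.
have -> : ord0 = ax0 by apply/val_inj.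
have -> : lift ax0 ord0 = ax1 by apply/val_inj.
have -> : lift ax0 (lift ord0 ord0) = ax2 by apply/val_inj.
have -> : lift ax1 ord0 = ax0 by apply/val_inj.
have -> : lift ax1 (lift ord0 ord0) = ax2 by apply/val_inj.
have -> : lift ax2 ord0 = ax0 by apply/val_inj.
have -> : lift ax2 (lift ord0 ord0) = ax1 by apply/val_inj.
have -> : lift ax0 (lift (lift ord0 ord0) 0) = ax1 by apply/val_inj.
have -> : lift ax1 (lift (lift ord0 ord0) 0) = ax0 by apply/val_inj.
have -> : lift ax2 (lift (lift ord0 ord0) 0) = ax0 by apply/val_inj.
rewrite /= /bump /=.
by ring.
Qed.

(** The Gram determinant of four vectors in 3-space vanishes; it is expanded along the row and
    column of [u]. *)
Lemma gram4 (R : realType) (u v w z : 'rV[R]_3) :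
  mdot u u * (mdot v v * mdot w w * mdot z z
      + mdot v w * mdot w z * mdot v z *+ 2 - mdot w w * mdot v z ^+ 2
      - mdot v v * mdot w z ^+ 2 - mdot z z * mdot v w ^+ 2) =
    mdot u v ^+ 2 * (mdot w w * mdot z z - mdot w z ^+ 2)
  + mdot u w ^+ 2 * (mdot v v * mdot z z - mdot v z ^+ 2)
  + mdot u z ^+ 2 * (mdot v v * mdot w w - mdot v w ^+ 2)
  + (mdot u v * mdot u w * (mdot w z * mdot v z - mdot v w * mdot z z)
  + mdot u v * mdot u z * (mdot v w * mdot w z - mdot w w * mdot v z)
  + mdot u w * mdot u z * (mdot v w * mdot v z - mdot v v * mdot w z)) *+ 2.
Proof. rewrite /mdot; ring. Qed.

Ltac in_ring := try assumption; lazymatch goal with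
  | |- is_true (_ + - _ \in _) => apply: rpredB; in_ring
  | |- is_true (_ + _ \in _) => apply: rpredD; in_ring
  | |- is_true (- _ \in _) => rewrite rpredN; in_ring
  | |- is_true (_ * _ \in _) => apply: rpredM; in_ring
  | |- is_true (_ ^+ _ \in _) => apply: rpredX; in_ring
  | |- is_true (_ *+ _ \in _) => apply: rpredMn; in_ring
  | |- _ => idtac
  end.

(** * Valuation rings and the growth of poles along a walk *)

Section Valuation.
Variables (R : realType) (O : subringClosed R).
Hypothesis OV : forall z : R, (z \in O) || (z^-1 \in O).

Lemma notin_valuation_neq0 (y : R) : y \notin O -> y != 0.
Proof. by apply: contraNneq => ->; rewrite rpred0. Qed.

Lemma inv_in_valuation (y : R) : y \notin O -> y^-1 \in O.
Proof. by move=> yO; have := OV y; rewrite (negPf yO). Qed.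

Lemma sqr_in_valuation (y : R) : y ^+ 2 \in O -> y \in O.
Proof.
move=> y2; apply/negPn/negP => yO; have yV := inv_in_valuation yO.
have y0 := notin_valuation_neq0 yO.
by move/negP: yO; apply; rewrite -(mulfK y0 y) -expr2 rpredM.
Qed.

(** [x^-1] and [y^-1] are non-units of a local ring. Multiplying by whichever of [x], [y] has the
    smaller pole would put that element in [O]. *)
Lemma nonunits_neq1 (x y s t : R) : x \notin O -> y \notin O ->
  s \in O -> t \in O -> 1 != x^-1 * s + y^-1 * t.
Proof.
move=> xO yO sO tO; apply/eqP => E.
have x0 := notin_valuation_neq0 xO; have y0 := notin_valuation_neq0 yO.
case/orP: (OV (x / y)) => zO.
  move/negP: xO; apply; rewrite (_ : x = s + x / y * t); first by in_ring.
  by rewrite -{1}(mulr1 x) E; field; rewrite y0 x0.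
move/negP: yO; apply; rewrite (_ : y = (x / y)^-1 * s + t); first by in_ring.
by rewrite -{1}(mulr1 y) E; field; rewrite y0 x0.
Qed.

(** The letters are the products in [gram4]: [y] is [mdot v z], and [A], [B], [C] are those of [u]
    with [v], [w], [z]. If [C / B] were in [O], the term [B ^+ 2 * y ^+ 2] would strictly dominate
    all others. *)
Lemma gram4_valuation (A B C y a d e f g h : R) :
  a \in O -> d \in O -> e \in O -> f \in O -> g \in O -> h \in O ->
  y \notin O -> B \notin O -> A / B \in O ->
  a * (d * f * h + e * g * y *+ 2 - f * y ^+ 2 - d * g ^+ 2 - h * e ^+ 2) =
    A ^+ 2 * (f * h - g ^+ 2) + B ^+ 2 * (d * h - y ^+ 2)
  + C ^+ 2 * (d * f - e ^+ 2)
  + (A * B * (g * y - e * h) + A * C * (e * g - f * y)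
     + B * C * (e * y - d * g)) *+ 2 ->
  C / B \notin O.
Proof.
move=> aO dO eO fO gO hO yO BO AB E; apply/negP => CB.
have y0 := notin_valuation_neq0 yO; have B0 := notin_valuation_neq0 BO.
have yV := inv_in_valuation yO; have BV := inv_in_valuation BO.
set al := A / B in AB *; set ga := C / B in CB *.
(* Division of the relation by [B ^+ 2 * y ^+ 2] gives [1 = y^-1 * s + B^-1 * t]. *)
pose s := al ^+ 2 * (f * h - g ^+ 2) * y^-1 + d * h * y^-1
  + ga ^+ 2 * (d * f - e ^+ 2) * y^-1
  + (al * (g - e * h * y^-1) + al * ga * (e * g * y^-1 - f)
     + ga * (e - d * g * y^-1)) *+ 2.
pose t := - (a * B^-1 * ((d * f * h - d * g ^+ 2 - h * e ^+ 2) * y^-1 ^+ 2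
  + e * g * y^-1 *+ 2 - f)).
have sO : s \in O by rewrite /s; in_ring.
have tO : t \in O by rewrite /t; in_ring.
move: (nonunits_neq1 yO BO sO tO) => /eqP; apply.
apply/eqP; rewrite -subr_eq0; apply/eqP.
transitivity ((a * (d * f * h + e * g * y *+ 2 - f * y ^+ 2 - d * g ^+ 2
    - h * e ^+ 2) - (A ^+ 2 * (f * h - g ^+ 2) + B ^+ 2 * (d * h - y ^+ 2)
  + C ^+ 2 * (d * f - e ^+ 2)
  + (A * B * (g * y - e * h) + A * C * (e * g - f * y)
     + B * C * (e * y - d * g)) *+ 2)) / (B ^+ 2 * y ^+ 2)).
  by rewrite /s /t /al /ga; field; rewrite y0 B0.
by rewrite E subrr mul0r.
Qed.

(* The ratio is part of the induction: it says that the products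
   [mdot (v 0) (v k)] have nondecreasing pole orders. *)
Lemma chain_mdot_notin (v : nat -> 'rV[R]_3) (n : nat) :
  (forall i, (i <= n)%N -> mdot (v i) (v i) \in O) ->
  (forall i, (i.+1 <= n)%N -> mdot (v i) (v i.+1) \in O) ->
  (forall i, (i.+2 <= n)%N -> mdot (v i) (v i.+2) \notin O) ->
  forall k, (k.+2 <= n)%N -> mdot (v 0%N) (v k.+2) \notin O /\
    mdot (v 0%N) (v k.+1) / mdot (v 0%N) (v k.+2) \in O.
Proof.
move=> v0 v1 v2; elim=> [|k IH] kn.
  split; first exact: v2.
  by rewrite rpredM ?v1 ?inv_in_valuation ?v2 // ltnW.
have [BO AB] := IH (ltnW kn).
(* The four vectors are [v 0], [v k.+1], [v k.+2], [v k.+3]; the short chord joins the second to the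
   fourth. *)
have CB : mdot (v 0%N) (v k.+3) / mdot (v 0%N) (v k.+2) \notin O.
  apply: (gram4_valuation _ _ _ _ _ _ _ BO AB (gram4 _ _ _ _)).
  - exact: v0.
  - by apply: v0; rewrite ltnW // ltnW.
  - by apply: v1; rewrite ltnW.
  - by apply: v0; rewrite ltnW.
  - exact: v1.
  - exact: v0.
  - exact: v2.
split; last by rewrite -invf_div inv_in_valuation.
apply: contra CB => CO; exact: rpredM CO (inv_in_valuation BO).
Qed.

End Valuation.

(** * Cocycles modulo a subring on a graph with short chords *)

Section Walk.
Variables (V : finType) (R : realType) (O : subringClosed R).
Variables (k : V -> V -> R) (e : rel V).

Fixpoint walk_sum (x : V) (s : seq V) : R :=
  if s is y :: s' then k x y + walk_sum y s' else 0.

Lemma walk_sum_cat x s1 s2 :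
  walk_sum x (s1 ++ s2) = walk_sum x s1 + walk_sum (last x s1) s2.
Proof.
by elim: s1 x => [|y s1 IH] x /=; rewrite ?add0r // IH addrA.
Qed.

Hypothesis k_cocycle : forall a b c, e a b -> e b c -> e a c ->
  k a b + k b c - k a c \in O.
Hypothesis e_chord : forall x s, path e x s -> e x (last x s) ->
  (3 <= size s)%N -> exists2 i, (i.+2 <= size s)%N &
    e (nth x (x :: s) i) (nth x (x :: s) i.+2).

(* Induction on the length, cutting off a triangle along a short chord. *)
Lemma closed_walk_sum x s : path e x s -> e x (last x s) ->
  walk_sum x s - k x (last x s) \in O.
Proof.
have [n] := ubnP (size s); elim: n s => // n IH s.
case: s => [|y [|z [|w s']]].
- by move=> _ _ /= xx; have := k_cocycle xx xx xx; rewrite addrK sub0r rpredN.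
- by move=> _ _ _ /=; rewrite addr0 subrr rpred0.
- by move=> _ /and3P[xy yz _] /= xz; rewrite addr0 k_cocycle.
set s := [:: y, z, w & s'] => sn xs exs.
have [i i2 ei] := e_chord xs exs isT.
(* Position [i.+1] of [x :: s] is position [i] of [s], so the chord bypasses [nth x s i]. *)
have sE : s = take i s ++ [:: nth x s i, nth x s i.+1 & drop i.+2 s].
  by rewrite -!drop_nth ?cat_take_drop // ltnW.
have lE : last x (take i s) = nth x (x :: s) i.
  rewrite (last_nth x) size_takel; last by rewrite 2?ltnW.
  by rewrite -[x :: take i s]/(take i.+1 (x :: s)) nth_take.
move: sn xs exs sE; move: lE ei; rewrite [nth x (x :: s) i.+2]/=.
set b := nth x s i; set c := nth x s i.+1.
move: (take i s) (drop i.+2 s) => s1 s2 <- ei sn xs exs sE.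
rewrite {}sE in sn xs exs *.
move: xs exs; rewrite cat_path last_cat /= => /and4P[p1 ab bc p2] exs.
have /IH : (size (s1 ++ c :: s2) < n)%N.
  by move: sn; rewrite !size_cat /= !addnS ltnS.
rewrite cat_path last_cat /= p1 ei p2 => /(_ isT exs) IHs.
have := rpredD IHs (k_cocycle ab bc ei).
by congr (_ \in O); rewrite !walk_sum_cat /=; ring.
Qed.

Hypothesis e_sym : symmetric e.
Hypothesis e_refl : forall a b, e a b -> e a a.

(** The cocycle relation at [x, y, x] and at [x, x, x] makes [k] antisymmetric modulo [O], so
    retracing a walk cancels its sum. *)
Lemma reverse_walk x s : path e x s -> exists s',
  [/\ path e (last x s) s', last (last x s) s' = x &
      walk_sum x s + walk_sum (last x s) s' \in O].
Proof.
elim: s x => [|y s IH] x /=; first by exists [::]; rewrite addr0 rpred0.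
move=> /andP[xy /IH[s' [p' l' w']]]; exists (rcons s' x).
rewrite rcons_path p' l' last_rcons e_sym xy; split=> //.
have xx := e_refl xy; have yx : e y x by rewrite e_sym.
have kxx := k_cocycle xx xx xx; rewrite addrK in kxx.
have := rpredD w' (rpredD (k_cocycle xy yx xx) kxx).
by congr (_ \in O); rewrite -cats1 walk_sum_cat /= l'; ring.
Qed.

(** By [closed_walk_sum], the sum of [k] along a walk from the root of a component depends only on
    the endpoint, modulo [O]. *)
Lemma exists_potential : exists h : V -> R,
  forall a b, e a b -> h b - h a - k a b \in O.
Proof.
have csym : connect_sym e by apply: sym_connect_sym.
have /choice[s sP] (b : V) : exists s : seq V,
    path e (fingraph.root e b) s /\ last (fingraph.root e b) s = b.
  have /connectP[s ps sE] : connect e (fingraph.root e b) b.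
    by rewrite csym connect_root.
  by exists s; rewrite -sE.
exists (fun b => walk_sum (fingraph.root e b) (s b)) => a b ab.
have [pa la] := sP a; have [pb lb] := sP b.
have rE : fingraph.root e a = fingraph.root e b by apply/(fingraph.rootP csym)/connect1.
have [s' []] := reverse_walk pa; rewrite la rE => p' l' w'.
(* The walk goes from [a] back to the root and out to [b]; the edge between [a] and [b] closes
   it. *)
have := @closed_walk_sum a (s' ++ s b).
rewrite cat_path p' l' pb last_cat l' lb => /(_ isT ab) cw.
have := rpredB cw w'.
by congr (_ \in O); rewrite walk_sum_cat l'; ring.
Qed.

End Walk.

(** * The volume of a surface modulo a valuation ring *)

(** Coherent orientation puts each directed edge in exactly one triangle. *)
Lemma sum_directed_edges (R : realType) (V : finType) (F : {set V * V * V})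
    (g : V -> V -> R) : closed_oriented_surface F ->
  \sum_(t in F) (g t.1.1 t.1.2 + g t.1.2 t.2 + g t.2 t.1.1) =
  \sum_(e : V * V | sedge F e.1 e.2) g e.1 e.2.
Proof.
move=> [F3 [_ [_ [Funiq _]]]].
transitivity (\sum_(t in F) \sum_(e : V * V | in_tri t e.1 e.2) g e.1 e.2).
  apply: eq_bigr => -[[a b] c] tF /=.
  have [ab ac bc] : [/\ a != b, a != c & b != c].
    move: (F3 _ tF); rewrite /tri_verts /= -finset.setUA cardsU1 cards2 !inE.
    by rewrite negb_or; case: eqP; case: eqP; case: eqP.
  rewrite (bigD1 (a, b)) /= ?eqxx // (bigD1 (b, c)) /=; last first.
    by rewrite !eqxx orbT /= xpair_eqE negb_and eq_sym ab.
  rewrite (big_pred1 (c, a)) /= ?addrA // => -[u w] /=; rewrite !xpair_eqE.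
  have [->|ua] := eqVneq u a.
    by rewrite (negPf ab) (negPf ac) /= orbF; case: (w == b).
  have [->|ub] := eqVneq u b; first by rewrite (negPf bc) /=; case: (w == c).
  by rewrite /= !andbT.
rewrite (exchange_big_dep (fun e : V * V => sedge F e.1 e.2)) /=; last first.
  by move=> t e tF te; apply/existsP; exists t; rewrite tF.
apply: eq_bigr => -[u w] /= /existsP[t /andP[tF tuw]].
rewrite (big_pred1 t) // => t'; apply/idP/eqP => [/andP[t'F t'uw]|->].
  exact: Funiq t'uw tuw.
by rewrite tF tuw.
Qed.

Section FiniteEdges.
Variables (R : realType) (O : subringClosed R).
Hypothesis OV : forall z : R, (z \in O) || (z^-1 \in O).
Hypothesis half : 2^-1 \in O.
Variables (V : finType) (p : V -> 'rV[R]_3).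

Let E : rel V := fun a b => mdist2 (p a) (p b) \in O.
Let f a b c := \det (mx3 (p a) (p b) (p c)).

Lemma finite_edgeC : symmetric E.
Proof. by move=> a b; congr (_ \in O); rewrite /mdist2 /mdot !mxE; ring. Qed.

Lemma finite_edge_refl a : E a a.
Proof. by rewrite /E /mdist2 /mdot subrr !mxE !mul0r subr0 addr0 rpred0. Qed.

(** Polarization at [q]; recovering the product from the distances divides by 2. *)
Lemma finite_edge_mdot q a b : E q a -> E q b ->
  E a b = (mdot (p a - p q) (p b - p q) \in O).
Proof.
rewrite /E => qa qb.
have eE : mdist2 (p a) (p b) = mdist2 (p q) (p a) + mdist2 (p q) (p b)
    - mdot (p a - p q) (p b - p q) *+ 2.
  by rewrite /mdist2 /mdot !mxE; ring.
apply/idP/idP => ab; last by rewrite eE; in_ring.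
have -> : mdot (p a - p q) (p b - p q) =
    2^-1 * (mdist2 (p q) (p a) + mdist2 (p q) (p b) - mdist2 (p a) (p b)).
  by rewrite eE; field.
by in_ring.
Qed.

(** The alternating sum is the determinant of the edge vectors at [q]. Its square is minus their
    Gram determinant, by the signature, and [O] is closed under square roots. *)
Lemma finite_tetrahedron q b c d : E q b -> E q c -> E q d ->
  E b c -> E c d -> E b d ->
  f b c d - f q c d + f q b d - f q b c \in O.
Proof.
move=> qb qc qd bc cd bd; apply: (sqr_in_valuation OV).
have [bO cO dO] : [/\ mdot (p b - p q) (p b - p q) \in O,
    mdot (p c - p q) (p c - p q) \in O & mdot (p d - p q) (p d - p q) \in O].
  by rewrite -!finite_edge_mdot // !finite_edge_refl.
have [bcO cdO bdO] : [/\ mdot (p b - p q) (p c - p q) \in O,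
    mdot (p c - p q) (p d - p q) \in O & mdot (p b - p q) (p d - p q) \in O].
  by rewrite -!finite_edge_mdot.
move: bO cO dO bcO cdO bdO.
set u := p b - p q; set v := p c - p q; set w := p d - p q.
move=> uO vO wO uvO vwO uwO.
have -> : (f b c d - f q c d + f q b d - f q b c) ^+ 2 =
    - (mdot u u * mdot v v * mdot w w + mdot u v * mdot v w * mdot u w *+ 2
      - mdot u u * mdot v w ^+ 2 - mdot v v * mdot u w ^+ 2
      - mdot w w * mdot u v ^+ 2).
  by rewrite /f !det_mx3 /u /v /w /mdot !mxE; ring.
by in_ring.
Qed.

Let fC12 a b c : f b a c = - f a b c.
Proof. by rewrite /f !det_mx3; ring. Qed.
Let fC23 a b c : f a c b = - f a b c.
Proof. by rewrite /f !det_mx3; ring. Qed.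
Let faa a b : f a a b = 0.
Proof. by rewrite /f !det_mx3; ring. Qed.

Lemma link_chord (q : V) (e : rel V) :
    (forall a b, e a b -> [/\ E q a, E q b & E a b]) ->
    forall x s, path e x s -> E x (last x s) -> (3 <= size s)%N ->
  exists2 i, (i.+2 <= size s)%N &
    E (nth x (x :: s) i) (nth x (x :: s) i.+2).
Proof.
move=> eE x s xs exs s3; apply: contrapT => noi.
pose v i := p (nth x (x :: s) i) - p q.
have step i : (i < size s)%N -> e (nth x (x :: s) i) (nth x (x :: s) i.+1).
  by move=> si; have /(pathP x)/(_ _ si) := xs.
have qE i : (i <= size s)%N -> E q (nth x (x :: s) i).
  case: i => [_|i si].
    by have [] := eE _ _ (step 0%N (ltnW (ltnW s3))).
  by have [] := eE _ _ (step i si).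
(* The index [(size s).-2] makes the conclusion concern the last vertex, whose product with the
   first is in [O] because the closing pair is finite. *)
have [] := @chain_mdot_notin _ _ OV v (size s) _ _ _ (size s).-2 _.
- move=> i si; rewrite -finite_edge_mdot ?qE //; exact: finite_edge_refl.
- move=> i si; rewrite -finite_edge_mdot ?qE // 1?ltnW //.
  by have [] := eE _ _ (step i si).
- move=> i si; rewrite -finite_edge_mdot ?qE // 2?ltnW //.
  by apply/negP => ei; apply: noi; exists i.
- by case: (size s) s3 => [|[|]].
have -> : (size s).-2.+2 = size s by case: (size s) s3 => [|[|]].
by rewrite -finite_edge_mdot ?qE // -last_nth exs.
Qed.

Lemma volume_cochain (W : seq V) : exists g : V -> V -> R,
  forall a b c, a \in W -> b \in W -> c \in W -> E a b -> E b c -> E a c ->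
    f a b c - (g b c - g a c + g a b) \in O.
Proof.
elim: W => [|q W [g gP]]; first by exists (fun _ _ => 0).
have [qW|qW] := boolP (q \in W).
  have sub : q :: W =i W by move=> a; rewrite inE; case: eqVneq => // ->.
  by exists g => a b c; rewrite !sub; apply: gP.
(* With [g q a = h a], the coboundary condition on the triangle [q, a, b] reads [h b - h a = k a b]
   modulo [O]. *)
pose k a b := g a b - f q a b.
pose e : rel V := fun a b =>
  [&& E q a, E q b, E a b, a \in W & b \in W].
have k_cocycle a b c : e a b -> e b c -> e a c -> k a b + k b c - k a c \in O.
  move=> /and5P[qa qb ab aW bW] /and5P[_ qc bc _ cW] /and5P[_ _ ac _ _].
  have := rpredB (finite_tetrahedron qa qb qc ab bc ac) (gP _ _ _ aW bW cW ab bc ac).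
  by congr (_ \in O); rewrite /k; ring.
have e_sym : symmetric e.
  by move=> a b; rewrite /e (finite_edgeC a b); apply/and5P/and5P => -[*]; split.
have e_refl a b : e a b -> e a a.
  by move=> /and5P[qa _ _ aW _]; rewrite /e qa aW finite_edge_refl.
have e_chord x s : path e x s -> e x (last x s) -> (3 <= size s)%N ->
    exists2 i, (i.+2 <= size s)%N &
      e (nth x (x :: s) i) (nth x (x :: s) i.+2).
  move=> xs exs s3; have [i i2 iE] : exists2 i, (i.+2 <= size s)%N &
      E (nth x (x :: s) i) (nth x (x :: s) i.+2).
    apply: (@link_chord q e) => //; last by case/and5P: exs.
    by move=> a b /and5P[].
  have step j : (j < size s)%N -> e (nth x (x :: s) j) (nth x (x :: s) j.+1).
    by move=> sj; have /(pathP x)/(_ _ sj) := xs.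
  have /and5P[qi _ _ iW _] := step i (ltnW i2).
  have /and5P[_ qi2 _ _ i2W] := step i.+1 i2.
  by exists i => //; apply/and5P; split.
have [h hP] := exists_potential k_cocycle e_chord e_sym e_refl.
have core a b : a \in W -> b \in W -> E q a -> E q b -> E a b ->
    f q a b - g a b + h b - h a \in O.
  move=> aW bW qa qb ab; have := hP a b; rewrite /e qa qb ab aW bW => /(_ isT).
  by congr (_ \in O); rewrite /k; ring.
(* [g] is extended antisymmetrically to pairs containing [q]; triangles that repeat [q] have
   determinant 0. *)
exists (fun a b => if a == q then (if b == q then 0 else h b) else
  if b == q then - h a else g a b) => a b c.
rewrite !inE; have [->|aq] := eqVneq a q; have [->|bq] := eqVneq b q;
  have [->|cq] := eqVneq c q => //=; rewrite ?faa.
- by move=> *; have := rpred0 O; congr (_ \in O); ring.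
- by move=> *; have := rpred0 O; congr (_ \in O); ring.
- by move=> *; rewrite fC23 faa; have := rpred0 O; congr (_ \in O); ring.
- move=> _ bW cW qb bc qc; have := core b c bW cW qb qc bc.
  by congr (_ \in O); ring.
- move=> *; rewrite fC12 fC23 faa; have := rpred0 O.
  by congr (_ \in O); ring.
- move=> aW _ cW aq' qc ac; rewrite fC12; move: aq'; rewrite finite_edgeC => qa.
  have := core a c aW cW qa qc ac; rewrite -rpredN.
  by congr (_ \in O); ring.
- move=> aW bW _ ab; rewrite finite_edgeC => qb; rewrite finite_edgeC => qa.
  rewrite fC23 fC12 opprK; have := core a b aW bW qa qb ab.
  by congr (_ \in O); ring.
- exact: gP.
Qed.

Lemma surface_det_sum_finite (F : {set V * V * V}) :
  closed_oriented_surface F -> (forall u w, sedge F u w -> E u w) ->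
  \sum_(t in F) f t.1.1 t.1.2 t.2 \in O.
Proof.
move=> HF FE; have [g gP] := volume_cochain (enum V).
have {}gP a b c : E a b -> E b c -> E a c ->
    f a b c - (g b c - g a c + g a b) \in O by apply: gP; rewrite mem_enum.
(* The degenerate triangles [a, b, a] and [a, a, a] make [g] antisymmetric modulo [O]. *)
have gC a b : E a b -> g a b + g b a \in O.
  move=> ab; have ba : E b a by rewrite finite_edgeC.
  have aa := finite_edge_refl a.
  have := rpredD (gP _ _ _ ab ba aa) (gP _ _ _ aa aa aa).
  rewrite fC23 !faa -rpredN.
  by congr (_ \in O); ring.
have edges t : t \in F -> [/\ E t.1.1 t.1.2, E t.1.2 t.2 & E t.2 t.1.1].
  move=> tF; split; apply: FE; apply/existsP; exists t; rewrite tF;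
    by case: t {tF} => -[a b] c /=; rewrite !eqxx ?orbT.
have symF : [rel u w | sedge F u w] =2 [rel u w | sedge F w u].
  have [_ [_ [_ [_ [Fop _]]]]] := HF.
  have sF u w : sedge F u w -> sedge F w u.
    by move=> /existsP[t /andP[tF tuw]]; apply: Fop tF tuw.
  by move=> u w /=; apply/idP/idP; apply: sF.
rewrite (_ : \sum_(t in F) _ = \sum_(t in F) (f t.1.1 t.1.2 t.2 -
    (g t.1.1 t.1.2 + g t.1.2 t.2 + g t.2 t.1.1)) +
    \sum_(t in F) (g t.1.1 t.1.2 + g t.1.2 t.2 + g t.2 t.1.1)); last first.
  by rewrite -big_split; apply: eq_bigr => t _ /=; rewrite subrK.
apply: rpredD.
  apply: rpred_sum => t /edges[ab bc ca].
  have ac : E t.1.1 t.2 by rewrite finite_edgeC.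
  have := rpredB (gP _ _ _ ab bc ac) (gC _ _ ac).
  by congr (_ \in O); ring.
rewrite sum_directed_edges //; set S := \sum_(e | _) _.
have SE : S = \sum_(e : V * V | sedge F e.1 e.2) g e.2 e.1.
  have swapK : involutive (fun e : V * V => (e.2, e.1)) by case.
  rewrite /S (reindex_inj (inv_inj swapK)) /=.
  by apply: eq_bigl => -[u w] /=; apply/esym/symF.
(* In [S + S] each directed edge is paired with its opposite. *)
have -> : S = 2^-1 * (S + S) by field.
apply: rpredM => //; rewrite {1}/S SE -big_split.
by apply: rpred_sum => -[u w] /= /FE; apply: gC.
Qed.

End FiniteEdges.

(** * Existence of valuation rings *)

Lemma horner_inv_mulX (K : fieldType) (O : subringClosed K) (p : {poly K})
    (w : K) : w != 0 -> w^-1 \in O -> p \is a polyOver O ->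
  p.[w] * w^-1 ^+ size p \in O.
Proof.
move=> w0 wO pO; rewrite horner_coef mulr_suml rpred_sum // => i _.
rewrite [X in _^-1 ^+ X](_ : _ = (i + (size p - i))%N); last first.
  by rewrite subnKC // ltnW.
rewrite exprD mulrA -(mulrA _ (w ^+ i)) -exprMn divff // expr1n mulr1.
by rewrite rpredM ?rpredX //; apply: (polyOverP pO).
Qed.

(* Any subring maximal among those containing [A] but not [x] will do: if
   neither [z] nor [z^-1] is in it, then [x] is a polynomial in each of them,
   and the two expressions can be used to lower each other's degree. *)
Lemma exists_valuation_ring (K : fieldType) (A : subringClosed K) (x : K) :
  x^-1 \in A -> x \notin A -> exists O : subringClosed K,
    [/\ {subset A <= O}, x \notin O & forall z, (z \in O) || (z^-1 \in O)].
Proof.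
move=> xVA xA.
pose good (B : set K) := [/\ B 1, forall a b, B a -> B b -> B (a - b),
  forall a b, B a -> B b -> B (a * b), forall z, z \in A -> B z & ~ B x].
pose P : set (set K) := [set B | B = set0 \/ good B]%classic.
have goodA : good [set` A]%classic.
  split=> //=; [exact: rpred1 | exact: rpredB | exact: rpredM | exact/negP].
have [M [PM Mmax]] : exists M, P M /\ forall B, (M `<` B)%classic -> ~ P B.
  apply: Zorn_bigcup => C CP Ctot.
  have gC B z : C B -> B z -> good B.
    by move=> CB Bz; have [B0|//] := CP _ CB; move: Bz; rewrite B0.
  have [[B0 [z0 [CB0 B0z0]]]|noB] := pselect (exists B z, C B /\ B z); last first.
    left; apply/seteqP; split => // z [B CB Bz]; apply: noB.
    by exists B, z.
  right; have [B01 _ _ B0A _] := gC _ _ CB0 B0z0.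
  have join a b : (\bigcup_(B in C) B)%classic a ->
      (\bigcup_(B in C) B)%classic b -> exists B, [/\ C B, B a, B b & good B].
    move=> [B1 C1 B1a] [B2 C2 B2b]; have [s|s] := Ctot _ _ C1 C2.
      by exists B2; split=> //; [exact: s | exact: gC B2b].
    by exists B1; split=> //; [exact: s | exact: gC B1a].
  split.
  - by exists B0.
  - move=> a b Ua Ub; have [B [CB Ba Bb [_ BB _ _ _]]] := join _ _ Ua Ub.
    by exists B => //; apply: BB.
  - move=> a b Ua Ub; have [B [CB Ba Bb [_ _ BB _ _]]] := join _ _ Ua Ub.
    by exists B => //; apply: BB.
  - by move=> z zA; exists B0 => //; apply: B0A.
  - by move=> [B CB Bx]; have [_ _ _ _] := gC _ _ CB Bx; apply.
have {PM} [M1 MB MM AM Mx] : good M.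
  case: PM => // M0; exfalso; apply: (Mmax [set` A]%classic); last by right.
  rewrite M0; split; first exact: sub0set.
  by move=> /(_ 1); apply; rewrite /= rpred1.
have Mring : subring_closed (fun z : K => `[< M z >]).
  split=> [|a b /asboolP Ma /asboolP Mb|a b /asboolP Ma /asboolP Mb].
  - exact/asboolP.
  - exact/asboolP/MB.
  - exact/asboolP/MM.
pose O : subringClosed K := HB.pack (fun z : K => `[< M z >] : bool)
  (GRing.isSubringClosed.Build K (fun z : K => `[< M z >]) Mring).
have inO z : (z \in O) = `[< M z >] by [].
have xO : x \notin O by rewrite inO; apply/asboolP.
have AO : {subset A <= O} by move=> z zA; rewrite inO; exact/asboolP/AM.
have xVO : x^-1 \in O by exact: AO.
have x0 : x != 0 by apply: contraNneq xO => ->; rewrite rpred0.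
exists O; split=> //.
(* By maximality, the strictly larger ring obtained by adjoining [z] contains [x]. *)
have adjoin z : z \notin O -> exists2 p, p \is a polyOver O & p.[z] = x.
  move=> zO.
  pose B : set K := [set y | exists2 p, p \is a polyOver O & p.[z] = y]%classic.
  apply: contrapT => noB; apply: (Mmax B).
    split=> [y My|BM].
      by exists y%:P; rewrite ?hornerC // polyOverC inO; apply/asboolP.
    move/negP: zO; apply; rewrite inO; apply/asboolP/BM.
    by exists 'X; rewrite ?polyOverX ?hornerX.
  right; split=> //.
  - by exists 1; rewrite ?rpred1 ?hornerC.
  - move=> a b [p pO <-] [q qO <-].
    by exists (p - q); rewrite ?rpredB ?hornerD ?hornerN.
  - move=> a b [p pO <-] [q qO <-].
    by exists (p * q); rewrite ?rpredM ?hornerM.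
  - by move=> y yA; exists y%:P; rewrite ?hornerC // polyOverC AO.
(* Otherwise [x] is a polynomial in [u^-1], so [x * u ^+ n] is in [O] for some [n]; the relation
   [x = x * u + a] lowers [n] to 0. *)
have unitO a : a \in O -> (1 - x^-1 * a != 0) && ((1 - x^-1 * a)^-1 \in O).
  move=> aO; set u := 1 - _.
  have uO : u \in O by rewrite rpredB ?rpred1 ?rpredM.
  have u0 : u != 0.
    rewrite subr_eq0; apply: contraNneq xO => e.
    by rewrite -(mulr1 x) e mulVKf.
  rewrite u0; apply/negPn/negP => wO; have [p pO px] := adjoin _ wO.
  have := @horner_inv_mulX _ _ _ u^-1 _ _ pO.
  rewrite px invrK invr_eq0 => /(_ u0 uO).
  elim: (size p) => [|k IH]; first by rewrite mulr1 (negPf xO).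
  move=> xu; apply: IH.
  have -> : x * u ^+ k = x * u ^+ k.+1 + a * u ^+ k.
    by rewrite /u exprS; field.
  by rewrite rpredD // rpredM // rpredX.
have descent n z (p q : {poly K}) : z != 0 -> p \is a polyOver O ->
    q \is a polyOver O -> (size p + size q < n)%N -> p.[z] = x ->
    q.[z^-1] = x -> False.
  elim: n z p q => // n IH z p q.
  wlog qp : z p q / (size q <= size p)%N => [wl|].
    have [/wl h|/ltnW pq] := leqP (size q) (size p); first exact: h.
    move=> z0 pO qO; rewrite addnC => s pz qz.
    have zV0 : z^-1 != 0 by rewrite invr_eq0.
    have := wl z^-1 q p pq zV0 qO pO s qz; rewrite invrK; exact.
  move=> z0 pO qO sn pz qz.
  case sp : (size p) => [|m].
    move/eqP: sp x0; rewrite size_poly_eq0 -pz => /eqP->.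
    by rewrite horner0 eqxx.
  have /andP[] := unitO _ (polyOverP qO 0%N).
  set u := 1 - _ => u0 wO.
  (* Multiplied by [z ^+ m], the equation [q.[z^-1] = x] expresses [z ^+ m] through lower powers,
     with factor [u^-1 * x^-1]; [p'] replaces the leading term of [p] accordingly. *)
  pose c := p`_m * u^-1 * x^-1.
  pose p' := \poly_(j < m) (p`_j + c * q`_(m - j)).
  apply: (IH z p' q z0 _ qO _ _ qz).
  - apply/polyOverP => j; rewrite coef_poly; case: ifP => _; last exact: rpred0.
    have pj k : p`_k \in O by apply: (polyOverP pO).
    have qk k : q`_k \in O by apply: (polyOverP qO).
    by rewrite rpredD // /c !rpredM.
  - have : (size p' <= m)%N by apply: size_poly.
    move: sn; rewrite sp; lia.
  have qE : \sum_(j < m) q`_(m - j) * z ^+ j = z ^+ m * (x - q`_0).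
    have := horner_coef_wide z^-1 (leq_trans qp (eq_leq sp)).
    rewrite qz big_ord_recl /= expr0 mulr1 => ->; rewrite addrAC subrr add0r.
    rewrite mulr_sumr (reindex_inj rev_ord_inj) /=.
    apply: eq_bigr => j _; rewrite /bump /= add1n (subKn (ltn_ord j)).
    rewrite mulrCA; congr (_ * _); rewrite exprVn.
    by rewrite expfB_cond ?(negPf z0) ?add0n.
  rewrite horner_poly -pz horner_coef sp big_ord_recr /=.
  under eq_bigr do rewrite mulrDl.
  rewrite big_split /=; congr (_ + _).
  under eq_bigr do rewrite -mulrA.
  rewrite -mulr_sumr qE /c.
  have -> : x - q`_0 = x * u by rewrite /u; field.
  by field; rewrite x0 u0.
move=> z; apply/negPn/negP; rewrite negb_or => /andP[zO zVO].
have z0 : z != 0 by apply: contraNneq zO => ->; rewrite rpred0.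
have [p pO pz] := adjoin _ zO; have [q qO qz] := adjoin _ zVO.
exact: descent z0 pO qO (ltnSn _) pz qz.
Qed.

(** * Countability of the integral elements *)

(* Words in the ring operations; the leaves 0 and 1 stand for the variable
   and 1/2, the leaf [i.+2] for [l`_i]. *)
Fixpoint word_poly (R : realType) (l : seq R) (w : GenTree.tree nat) : {poly R} :=
  match w with
  | GenTree.Leaf 0%N => 'X
  | GenTree.Leaf 1%N => (2^-1)%:P
  | GenTree.Leaf i.+2 => (l`_i)%:P
  | GenTree.Node 0%N [:: a; b] => word_poly l a - word_poly l b
  | GenTree.Node 1%N [:: a; b] => word_poly l a * word_poly l b
  | GenTree.Node _ _ => 1
  end.

(** The words do not depend on [y]: one countable supply describes the rings generated by [y], 1/2
    and [l] for all [y]. *)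
Lemma exists_adjoin_ring (R : realType) (l : seq R) (y : R) :
  exists A : subringClosed R, [/\ forall z, z \in A ->
      exists w, z = (word_poly l w).[y],
    y \in A, 2^-1 \in A & {subset l <= A}].
Proof.
pose M z := `[< exists w, z = (word_poly l w).[y] >].
have Mring : subring_closed M.
  split=> [|a b /asboolP[v ->] /asboolP[w ->]|a b /asboolP[v ->] /asboolP[w ->]].
  - by apply/asboolP; exists (GenTree.Node 0 [::]); rewrite hornerC.
  - by apply/asboolP; exists (GenTree.Node 0 [:: v; w]); rewrite hornerD hornerN.
  - by apply/asboolP; exists (GenTree.Node 1 [:: v; w]); rewrite hornerM.
pose A : subringClosed R := HB.pack (M : R -> bool)
  (GRing.isSubringClosed.Build R M Mring).
exists A; split.
- by move=> z /asboolP.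
- by apply/asboolP; exists (GenTree.Leaf 0%N); rewrite hornerX.
- by apply/asboolP; exists (GenTree.Leaf 1%N); rewrite hornerC.
- move=> z zl; apply/asboolP; exists (GenTree.Leaf (index z l).+2).
  by rewrite hornerC nth_index.
Qed.

Lemma finite_roots (R : idomainType) (p : {poly R}) : p != 0 ->
  finite_set [set x | root p x]%classic.
Proof.
have [n] := ubnP (size p); elim: n p => // n IH p sp p0.
have [[a pa]|nop] := pselect (exists a, root p a); last first.
  rewrite (_ : mkset _ = set0) ?finite_set0 //.
  by apply/seteqP; split=> // x px; apply: nop; exists x.
have /factor_theorem[q pE] := pa.
have q0 : q != 0 by apply: contraNneq p0 => q0; rewrite pE q0 mul0r.
apply: (@sub_finite_set _ _ ([set a] `|` [set x | root q x])%classic).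
  move=> x /=; rewrite pE rootM root_XsubC.
  by case/orP => [qx|/eqP->]; [right|left].
rewrite finite_setU; split; first exact: finite_set1.
by apply: IH => //; move: sp; rewrite pE size_mul ?polyXsubC_eq0 // size_XsubC addn2.
Qed.

(** For nonzero [x], clearing denominators gives a monic equation for [x]. Each of the countably
    many words has finitely many solutions. *)
Lemma countable_integral (R : realType) (l : seq R) :
  countable [set x : R | exists w, x = (word_poly l w).[x^-1]]%classic.
Proof.
(* The second factor is -1 at 0, hence nonzero; the first accounts for [x = 0], whose inverse is
   0. *)
pose q w := 'X * ('X * word_poly l w - 1).
have q0 w : q w != 0.
  rewrite mulf_neq0 ?polyX_eq0 //; apply/eqP => /(congr1 (horner^~ 0)).
  by rewrite !hornerE ?mul0r ?sub0r => /eqP; rewrite oppr_eq0 oner_eq0.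
apply: (@sub_countable _ _ _
  ((@GRing.inv R) @` (\bigcup_w [set y | root (q w) y]))%classic).
  apply: subset_card_le => x /= [w xw]; exists x^-1; last by rewrite invrK.
  exists w => //=; rewrite /root /q !hornerE mulf_eq0 -xw.
  by have [->|x0] := eqVneq x 0; rewrite ?invr0 ?eqxx // mulVf // subrr eqxx orbT.
apply: sub_countable (card_image_le _ _) _; apply: bigcup_countable => //.
by move=> w _; apply/finite_set_countable/finite_roots.
Qed.

(** * Continuity and countable sets of values *)

(** By the intermediate value theorem, [A] would otherwise contain an interval of positive Lebesgue
    measure. *)
Lemma continuous_countable_const (R : realType) (f : R -> R) (A : set R) :
  continuous f -> countable A -> (forall t, 0 <= t <= 1 -> A (f t)) ->
  forall t, 0 <= t <= 1 -> f t = f 0.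
Proof.
move=> fc cA fA t /andP[t0 t1]; apply: contrapT => ne.
pose a := Num.min (f 0) (f t); pose b := Num.max (f 0) (f t).
have ab : a < b by rewrite /a /b; case: (ltgtP (f 0) (f t)) => // /esym/ne.
have sub : (`[a, b] `<=` A)%classic.
  move=> v; rewrite set_itvcc /= => vab.
  have [c] := IVT t0 (continuous_subspaceT fc) vab.
  rewrite in_itv /= => /andP[c0 ct] <-; apply: fA.
  by rewrite c0 (le_trans ct).
have := countable_lebesgue_measure0 (sub_countable (subset_card_le sub) cA).
rewrite lebesgue_measure_itv /= lte_fin ab => /eqP.
by rewrite -EFinB eqe subr_eq0 gt_eqF.
Qed.

(** Convergence at one other point [t1] bounds the terms there, and nearer to [t0] a geometric
    series dominates. *)
Lemma analytic01_lipschitz_at (R : realType) (f : R -> R) (t0 : R) :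
  analytic01 f -> 0 <= t0 <= 1 -> exists C d, [/\ 0 < C, 0 < d &
    forall s, 0 <= s <= 1 -> `|s - t0| < d -> `|f s - f t0| <= C * `|s - t0|].
Proof.
move=> fA t01; have [r [r0 [a fa]]] := fA _ t01.
pose u (s : R) (n : nat) := \sum_(k < n) a k * (s - t0) ^+ k.
have f0 : f t0 = a 0%N.
  have c0 : (u t0 @ \oo --> f t0)%classic by apply: fa; rewrite // subrr normr0.
  have : (u t0 @ \oo --> a 0%N)%classic.
    rewrite -cvg_shiftS; apply: cvg_near_cst; apply: nearW => n.
    rewrite /u /= big_ord_recl subrr expr0 mulr1 big1 ?addr0 // => i _.
    by rewrite lift0 expr0n mulr0.
  by move/(cvg_unique _ c0); apply.
(* A radius of at most 1/2 keeps [t0 + rho] or [t0 - rho] in the unit interval. *)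
pose rho := Num.min (r / 2) (1 / 2).
have rho0 : 0 < rho by rewrite lt_min !divr_gt0.
have rho2 : rho <= 1 / 2 by rewrite ge_min lexx orbT.
have rhor : rho < r.
  by rewrite (@le_lt_trans _ _ (r / 2)) ?ge_min ?lexx // ltr_pdivrMr // ltr_pMr ?ltr1n.
have [t1 [t101 t1E]] : exists t1, 0 <= t1 <= 1 /\ `|t1 - t0| = rho.
  case/andP: t01 => t00 t01; have [t2|t2] := leP t0 (1 / 2).
    exists (t0 + rho); split; last by rewrite addrC addKr gtr0_norm.
    by apply/andP; split; lra.
  exists (t0 - rho); split; first by apply/andP; split; lra.
  by rewrite addrC addKr normrN gtr0_norm.
have c1 : cvgn (u t1) by apply/cvg_ex; exists (f t1); apply: fa; rewrite // t1E.
have [M M0 /= uM] := pinfty_ex_gt0 (cvg_seq_bounded c1).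
have aM k : `|a k| * rho ^+ k <= 2 * M.
  have -> : `|a k| * rho ^+ k = `|u t1 k.+1 - u t1 k|.
    by rewrite /u big_ord_recr /= addrAC subrr add0r normrM normrX t1E.
  by rewrite (le_trans (ler_normB _ _)) // mulr_natl mulr2n lerD ?uM.
exists (2 * M * 2 / rho), (rho / 2); split.
- by rewrite !mulr_gt0 ?invr_gt0.
- by rewrite divr_gt0.
move=> s s01 sd; have cs : (u s @ \oo --> f s)%classic.
  by apply: fa => //; rewrite (lt_trans sd) // (le_lt_trans _ rhor) //; lra.
set q := `|s - t0| / rho.
have q0 : 0 <= q by rewrite divr_ge0 // ltW.
have q2 : 2 * q <= 1.
  by rewrite /q mulrA ler_pdivrMr // mul1r; lra.
(* Since [q <= 1 / 2], the last factor majorizes the sum of [q ^+ k] for [k] from 1 to [n]; the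
   subtracted power carries the induction. *)
have bound n : `|u s n.+1 - a 0%N| <= 2 * M * (2 * q - 2 * q ^+ n.+1).
  elim: n => [|n IH].
    by rewrite /u big_ord1 expr0 mulr1 subrr normr0 expr1 subrr mulr0.
  rewrite /u big_ord_recr /= -/(u s n.+1) addrAC.
  rewrite (le_trans (ler_normD _ _)) //.
  have : `|a n.+1 * (s - t0) ^+ n.+1| <= 2 * M * q ^+ n.+1.
    rewrite normrM normrX -[`|s - t0|](divfK (lt0r_neq0 rho0)) -/q exprMn.
    by rewrite mulrCA mulrC ler_wpM2r ?exprn_ge0 // mulrC.
  move=> h; rewrite (le_trans (lerD IH h)) // -mulrDr ler_pM2l ?mulr_gt0 //.
  have : 0 <= q ^+ n.+1 * (1 - 2 * q) by rewrite mulr_ge0 ?exprn_ge0 ?subr_ge0.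
  by rewrite [q ^+ n.+2]exprS; nra.
have {}bound n : `|u s n.+1 - a 0%N| <= 2 * M * 2 / rho * `|s - t0|.
  rewrite (le_trans (bound n)) // (_ : _ * `|_| = 2 * M * (2 * q)); last first.
    by rewrite /q; field; rewrite gt_eqF.
  rewrite ler_pM2l ?mulr_gt0 // gerBl mulr_ge0 ?exprn_ge0 //.
have cs1 : ((fun n => u s n.+1) @ \oo --> f s)%classic by rewrite cvg_shiftS.
have cn : ((fun n => `|u s n.+1 - a 0%N|) @ \oo --> `|f s - a 0%N|)%classic.
  exact: (cvg_norm (cvgB cs1 (cvg_cst _))).
by rewrite f0; exact: (ler_cvg_to cn (cvg_cst _) (nearW _ bound)).
Qed.

(** Nothing is known of [f] outside the unit interval, so it is precomposed with the retraction of
    the line onto it. *)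
Lemma analytic01_continuous (R : realType) (f : R -> R) : analytic01 f ->
  continuous (fun t : R => f (Num.max 0 (Num.min 1 t))).
Proof.
move=> fA t; pose cl (t : R) := Num.max 0 (Num.min 1 t).
have cl01 s : 0 <= cl s <= 1.
  by rewrite /cl le_max lexx ge_max ler01 /= ge_min lexx.
have clc : {for t, continuous cl}.
  apply: (@continuous_max R R (cst 0) (fun s => Num.min 1 s)).
    exact: cst_continuous.
  apply: (@continuous_min R R (cst 1) id); first exact: cst_continuous.
  exact: cvg_id.
have [C [d [C0 d0 fL]]] := analytic01_lipschitz_at fA (cl01 t).
apply/cvgrPdist_lt => e e0; rewrite -/(cl t).
have m0 : 0 < Num.min d (e / C) by rewrite lt_min d0 divr_gt0.
move/cvgrPdist_lt: clc => /(_ _ m0); apply: filterS => s /=.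
rewrite lt_min distrC => /andP[sd se]; rewrite distrC.
rewrite (le_lt_trans (fL _ (cl01 s) sd)) //.
by rewrite -ltr_pdivlMl // mulrC.
Qed.

(** * The volume along the flex *)

Theorem theorem2 (R : realType) (V : finType) (F : {set V * V * V})
    (HF : closed_oriented_surface F) (P : R -> V -> 'rV[R]_3)
    (HP : nontrivial_flex F P) :
  forall t : R, 0 <= t <= 1 -> gvol F (P t) = gvol F (P 0).
Proof.
have [_ Pan Pedge _] := HP.
pose vol6 t := \sum_(d in F) \det (mx3 (P t d.1.1) (P t d.1.2) (P t d.2)).
pose cl (t : R) : R := Num.max 0 (Num.min 1 t).
pose l := [seq mdist2 (P 0 e.1) (P 0 e.2) | e <- enum {: V * V}].
have clE t : 0 <= t <= 1 -> cl t = t.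
  by rewrite /cl => /andP[t0 t1]; rewrite (min_idPr t1) (max_idPr t0).
have vol_alg t : 0 <= t <= 1 -> exists w, vol6 t = (word_poly l w).[(vol6 t)^-1].
  (* Integrality of [vol6 t] takes the form of membership in the ring [A] generated with its
     inverse; if this failed, a valuation ring would contradict [surface_det_sum_finite]. *)
  move=> t01; have [A [AE yA hA lA]] := exists_adjoin_ring l (vol6 t)^-1.
  apply: AE; apply/negPn/negP => xA.
  have [B [AB /negP xB BV]] := exists_valuation_ring yA xA.
  apply: xB; apply: (surface_det_sum_finite BV (AB _ hA) HF) => u w uw.
  rewrite Pedge //; apply/AB/lA/mapP; exists (u, w) => //.
  by rewrite mem_enum.
have vol_cont : continuous (vol6 \o cl).
  have Pc v i : continuous (fun t : R => P (cl t) v 0 i).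
    exact: (analytic01_continuous (Pan v i)).
  apply: (@continuous_big R _ +%R 0 (mem F) (@add_continuous R) R _
    (fun d t => \det (mx3 (P (cl t) d.1.1) (P (cl t) d.1.2) (P (cl t) d.2)))).
  move=> d _ x.
  under eq_fun do rewrite det_mx3.
  by do !(apply: cvgD || apply: cvgN || apply: cvgM); apply: Pc.
move=> t t01; rewrite /gvol -/(vol6 t) -/(vol6 0); congr (_ * _).
have := continuous_countable_const vol_cont (countable_integral l) _ t01.
rewrite /= !clE ?lexx ?ler01 //; apply => s s01.
by rewrite /= clE //; apply: vol_alg.
Qed.
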